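(* Let $\lambda=\lim_{n\to\infty}\lambda_n$ be the cardinal defined by $\lambda_0=\omega_0$ and $\lambda_{n+1}=2^{\lambda_n}$ for $n\ge 0$. Let $\Lambda$ be a set whose cardinality is at least $\lambda$, let $n\in\mathbb N$ (with $n\ge1$), and let $\sigma:[\Lambda]^n\to\mathcal C$ be a map into an arbitrary set $\mathcal C$. Then at least one of the following conditions holds: (1) There is a sequence $(F_j)_{j=1}^\infty$ of pairwise disjoint elements of $[\Lambda]^n$ such that $\sigma(F_i)=\sigma(F_j)$ for all $i,j\in\mathbb N$. (2) There is an $F\in[\Lambda]^{n-1}$ such that the set $\sigma\big(\{F\cup\{\gamma\}:\gamma\in\Lambda\setminus F\}\big)$ is infinite.
   Context: For a set $\Lambda$ and an integer $k\ge0$, $[\Lambda]^k$ denotes the set of subsets of $\Lambda$ having exactly $k$ elements. *)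

(* Defs.v *)
From HB Require Import structures.
From mathcomp Require Import all_boot.
From mathcomp Require Import zify.
From mathcomp Require Import boolp classical_sets functions cardinality.

Set Implicit Arguments.
Unset Strict Implicit.
Unset Printing Implicit Defensive.

Local Open Scope classical_set_scope.
Local Open Scope card_scope.

(* Cardinals are represented by types and compared with [#<=].  The type
   [beth n] has cardinality lambda_n: the subsets of a set of cardinality
   lambda_n form a set of cardinality 2 ^ lambda_n. *)
Fixpoint beth (n : nat) : Type := if n is m.+1 then set (beth m) else nat.

(* lambda is the supremum of the increasing sequence lambda_n.  It is realized
   by the disjoint union of the [beth n]; [beth_le_omega] and [beth_omega_lub]
   below show that this is their least upper bound for [#<=]. *)
Definition beth_omega : Type := {n : nat & beth n}.

Definition subsets_of_card (L : Type) (k : nat) : set (set L) :=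
  [set F | F #= `I_k].
Arguments subsets_of_card : clear implicits.

Definition injects (T U : Type) : Prop := exists f : T -> U, injective f.

Lemma card_le_injects (T U : Type) :
  ([set: T] #<= [set: U]) <-> injects T U.
Proof.
split=> [/card_leP[f]|[f injf]].
  have xT (x : T) : x \in [set: T] by rewrite in_setT.
  exists (fun x => val (f (exist _ x (xT x)))) => x y /val_inj exy.
  by have /(congr1 val) := 'inj_f (in_setT _) (in_setT _) exy.
rewrite -(card_le_eql (inj_card_eq (in2W injf))).
exact: subset_card_le.
Qed.

Lemma injects_trans (T U V : Type) : injects T U -> injects U V -> injects T V.
Proof. by move=> [f fi] [g gi]; exists (g \o f); exact: inj_comp. Qed.

Lemma injects_sum (T U T' U' : Type) :
  injects T T' -> injects U U' -> injects (T + U) (T' + U').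
Proof.
move=> [f fi] [g gi].
exists (fun s => match s with inl x => inl (f x) | inr y => inr (g y) end).
by move=> [x|x] [y|y] // [] => [/fi|/gi] ->.
Qed.

Lemma injects_prod (T U T' U' : Type) :
  injects T T' -> injects U U' -> injects (T * U) (T' * U').
Proof.
move=> [f fi] [g gi]; exists (fun s => (f s.1, g s.2)).
by move=> [x y] [x' y'] [/= /fi -> /gi ->].
Qed.

Lemma injects_set (T U : Type) : injects T U -> injects (set T) (set U).
Proof.
move=> [f fi]; exists (fun A => f @` A) => A B eAB; apply/funext => x.
by rewrite -(image_inj (A := A) fi) eAB (image_inj fi).
Qed.

Lemma Cantor_injects (T : Type) : ~ injects (set T) T.
Proof.
move=> [i ii]; pose D := [set i X | X in [set X | ~ X (i X)]].
have [DD|nDD] := pselect (D (i D)); last by apply: (nDD); exists D.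
by case: (DD) => X nX /ii XD; rewrite XD in nX.
Qed.

Lemma injects_bethS (n : nat) : injects (beth n) (beth n.+1).
Proof.
exists (fun x => [set x] : set (beth n)) => x y exy.
by have : [set y] x by rewrite -exy.
Qed.

Lemma injects_beth (m n : nat) : (m <= n)%N -> injects (beth m) (beth n).
Proof.
move=> /subnK <-; elim: (n - m)%N => [|k IH]; first by exists id.
exact: injects_trans IH (injects_bethS _).
Qed.

Lemma injects_beth_sum (n : nat) : injects (beth n + beth n) (beth n.+1).
Proof.
have [e ei] := injects_beth (leq0n n).
have setN (x y : beth n) : [set x] = ~` [set y] -> False.
  move=> exy.
  have xORy (z : beth n) : z = x \/ z = y.
    have [->|nzy] := pselect (z = y); first by right.
    by left; have : [set x] z by rewrite exy.
  case: (xORy (e 0%N)) (xORy (e 1%N)) (xORy (e 2%N)) => h0 [] h1 [] h2;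
  first [ by have /ei := etrans h0 (esym h1) | by have /ei := etrans h0 (esym h2)
        | by have /ei := etrans h1 (esym h2) ].
exists (fun s => match s with inl x => [set x] | inr y => ~` [set y] end
                 : set (beth n)).
move=> [x|x] [y|y] exy; [|by case: (setN _ _ exy)|by case: (setN _ _ (esym exy))|].
  by have -> : x = y by have : [set y] x by rewrite -exy.
have -> // : x = y.
by apply: contrapT => nxy; have : (~` [set x]) x; [rewrite exy|apply].
Qed.

Lemma injects_beth_prod (n : nat) : injects (beth n * beth n) (beth n.+2).
Proof.
apply: injects_trans (injects_set (injects_beth_sum n)).
exists (fun s => [set inl s.1; inr s.2]) => -[x y] [x' y'] /= exy.
have xx : [set inl x'; inr y'] (inl x : beth n + beth n) by rewrite -exy; left.
have yy : [set inl x'; inr y'] (inr y : beth n + beth n) by rewrite -exy; right.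
by case: xx yy => // -[->] [] // [->].
Qed.

Fixpoint beth_before (n : nat) : Type :=
  if n is m.+1 then (beth_before m + beth m * beth (4 * m).+1)%type
  else Empty_set.

Lemma injects_beth_before (n : nat) : injects (beth_before n) (beth (4 * n)).
Proof.
elim: n => [|n IH].
  by exists (fun x : Empty_set => match x with end) => -[].
rewrite mulnS; apply: injects_trans (injects_beth_sum (4 * n).+3).
apply: injects_sum; first by apply: injects_trans IH (injects_beth _); lia.
apply: injects_trans (injects_beth_prod _).
by apply: injects_prod; [apply: injects_beth; lia|exists id].
Qed.

Lemma beth_le_omega (n : nat) : [set: beth n] #<= [set: beth_omega].
Proof.
apply/card_le_injects; exists (existT beth n) => x y.
exact: (@eq_from_Tagged nat beth).
Qed.

Lemma beth_omega_lub (M : Type) :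
  (forall n, [set: beth n] #<= [set: M]) -> [set: beth_omega] #<= [set: M].
Proof.
move=> bethM; apply/card_le_injects.
have prodM n : injects (beth n * beth (4 * n).+1) M.
  apply: injects_trans ((card_le_injects _ _).1 (bethM (4 * n).+3)).
  apply: injects_trans (injects_beth_prod _).
  by apply: injects_prod; [apply: injects_beth; lia|exists id].
pose f n := projT1 (cid (prodM n)).
have fi n : injective (f n) by exact: projT2 (cid (prodM n)).
pose F := fix F n : beth_before n -> M :=
  if n is m.+1 return beth_before n -> M then
    fun s => match s with inl t => F m t | inr p => f m p end
  else fun t => match t with end.
have F_lt n m p : (n < m)%N -> exists t, F m t = f n p.
  elim: m => // m IH; rewrite ltnS leq_eqVlt => /predU1P[nm|/IH[t Ft]].
    by case: m / nm IH; exists (inr p).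
  by exists (inl t).
have avoid n (x : beth n) : exists X, forall t, F n t <> f n (x, X).
  apply: contrapT => /forallNP noX.
  have /choice[t tE] X : exists t, F n t = f n (x, X).
    by apply: contrapT => /forallNP; exact: noX.
  apply: (@Cantor_injects (beth (4 * n))).
  apply: injects_trans (injects_beth_before n).
  by exists t => X Y /(congr1 (F n)); rewrite !tE => /fi[].
pose g n x := projT1 (cid (@avoid n x)).
have gP n x : forall t, F n t <> f n (x, g n x).
  exact: projT2 (cid (@avoid n x)).
have f_neq n m p x : (n < m)%N -> f n p <> f m (x, g m x).
  by move=> /(F_lt _ _ p)[t <-]; exact: gP.
exists (fun s => f (projT1 s) (projT2 s, g _ (projT2 s))).
move=> [n x] [m y] /=; case: (ltngtP n m) => [nm|mn|nm].
- by move/(f_neq _ _ _ _ nm).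
- by move/esym/(f_neq _ _ _ _ mn).
- by case: m / nm y => y /fi[->].
Qed.

(* Main.v *)
Require Import Defs.
From mathcomp Require Import all_boot.
From mathcomp Require Import zify.
From mathcomp Require Import boolp classical_sets functions cardinality.

Local Open Scope classical_set_scope.
Local Open Scope card_scope.

(** Suppose that (2) fails, so that the sets [F] with one point added always
    take finitely many colours when [F] has [n - 1] points.

    Place in [L] disjoint copies of types [X 0], [X 1], ..., [X (n-1)] such that
    no finite-to-one function goes from [X k] to [X 0 * ... * X (k-1)]; the
    cardinals [beth (5 * k + 3)] grow quickly enough for this.  Only sets with
    one point in each copy are used, and they are built by adding points to a
    set [H] from the top copy downwards.  Call a colour inevitable over [H] if
    every finite set [W] can be avoided, outside [H], by some set of that colour
    that is obtained from [H] by adding one point in each of the first [k]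
    copies.

    An inevitable colour exists over every [H] of the right cardinality, by
    induction on [k].  By induction, each point [z] of [X k] has a colour [c z]
    that is inevitable over [H] with [z] added, and some tuple [t z] in
    [X 0 * ... * X (k-1)] realizes this colour.  The function [t] takes one
    value [t0] at infinitely many [z].  For these [z] the colour [c z] is a
    colour of the set built from [H] and [t0], which has [n - 1] points, with
    the point [z] added; as (2) fails, only finitely many colours arise, and one
    of them, [c0], equals [c z] for infinitely many [z].  Then [c0] is
    inevitable over [H]: given [W], first choose such a [z] outside [W], then
    use that [c z] is inevitable.  This is [inevitable_colour].

    For [k = n] and [H] empty, sets of an inevitable colour can be chosen one
    after the other, each avoiding the union of the previous ones
    ([disjoint_sequence]). *)

(** Numbering the points of each fibre turns a finite-to-one function from [Z]
    to [T] into an injection of [Z] into [T * nat]. *)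
Lemma infinite_fibre (Z T : Type) (f : Z -> T) :
  ~ injects Z (T * nat) -> exists t, infinite_set (f @^-1` [set t]).
Proof.
move=> nZT; apply: contrapT => /forallNP fin_f; apply: nZT.
have /choice[g gI] t :
    exists h : Z -> nat, {in f @^-1` [set t] &, injective h}.
  by apply/countable_injP; apply: finite_set_countable; exact: contrapT (fin_f t).
exists (fun z => (f z, g (f z) z)) => x y [fxy].
by rewrite -fxy; apply: gI; rewrite inE //= fxy.
Qed.

Lemma infinite_pigeonhole (Z C : Type) (A : set Z) (c : Z -> C) :
  infinite_set A -> finite_set (c @` A) ->
  exists c0, infinite_set (A `&` c @^-1` [set c0]).
Proof.
move=> infA fin_cA; apply: contrapT => /forallNP fin_fibre; apply: infA.
apply: (@sub_finite_set _ _ (\bigcup_(c0 in c @` A) (A `&` c @^-1` [set c0]))).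
  by move=> z Az; exists (c z); [exists z|].
by apply: bigcup_finite => // c0 _; exact: contrapT (fin_fibre c0).
Qed.

Lemma card_eq_setU1 (T : Type) (A : set T) (x : T) (m : nat) :
  ~ A x -> A #= `I_m -> (x |` A) #= `I_m.+1.
Proof.
move=> nAx cardA; apply/eq_cardSP; exists x; first by left.
suff -> : (x |` A) `\ x = A by [].
apply/seteqP; split=> [y [[]//]|y Ay].
by split; [right|move=> yx; apply: nAx; rewrite -yx].
Qed.

Fixpoint tuples (X : nat -> Type) (k : nat) : Type :=
  if k is j.+1 then (tuples X j * X j)%type else unit.

(** [beth (5 * k)] bounds the product of the first [k] types: a factor [nat]
    takes two more levels, one level more gives a strictly larger type, and the
    next product takes two levels again. *)
Lemma injects_tuples_beth (k : nat) :
  injects (tuples (fun j => beth (5 * j + 3)) k) (beth (5 * k)).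
Proof.
elim: k => [|k IH]; first by exists (fun=> 0) => -[] [].
have -> : 5 * k.+1 = (5 * k + 3).+2 by lia.
apply: injects_trans (injects_beth_prod _).
apply: injects_prod; last by exists id.
by apply: injects_trans IH _; apply: injects_beth; lia.
Qed.

Lemma beth_not_injects_tuples (k : nat) :
  ~ injects (beth (5 * k + 3)) (tuples (fun j => beth (5 * j + 3)) k * nat).
Proof.
have -> : 5 * k + 3 = (5 * k).+3 by lia.
move=> inj; apply: (@Cantor_injects (beth (5 * k).+2)).
apply: injects_trans inj _.
apply: injects_trans (injects_beth_prod _).
apply: injects_prod; first exact: injects_tuples_beth.
exact: (injects_beth (leq0n _)).
Qed.

Fixpoint adjoin (L : Type) (X : nat -> Type) (e : {j & X j} -> L) (k : nat) :
    set L -> tuples X k -> set L :=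
  if k is j.+1 then fun H t => adjoin L X e j (e (existT X j t.2) |` H) t.1
  else fun H _ => H.
Arguments adjoin {L X} e {k}.

(** Under this condition [adjoin] adds [k] new points to [H], so that it
    controls the number of points. *)
Definition misses_copies {L : Type} {X : nat -> Type} (e : {j & X j} -> L)
    (k : nat) (H : set L) : Prop :=
  forall j (x : X j), j < k -> ~ H (e (existT X j x)).

Section Adjoin.
Context {L : Type} {X : nat -> Type} (e : {j & X j} -> L).
Hypothesis e_inj : injective e.

Lemma adjoinU1 k (H : set L) (x : L) (t : tuples X k) :
  adjoin e (x |` H) t = x |` adjoin e H t.
Proof. by elim: k H t => //= k IH H [t z] /=; rewrite setUCA IH. Qed.

Lemma adjoin_sub k (H : set L) (t : tuples X k) :
  adjoin e H t `<=` H `|` [set e s | s in [set s | projT1 s < k]].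
Proof.
elim: k H t => [|k IH] H /= t; first by move=> x Hx; left.
move=> x /IH[[->|Hx]|[s sk <-]]; [right|by left|right].
  by exists (existT X k t.2) => /=.
by exists s => //=; apply: ltnW.
Qed.

Lemma misses_copiesU1 k (H : set L) (z : X k) :
  misses_copies e k.+1 H -> misses_copies e k (e (existT X k z) |` H).
Proof.
move=> missH j x jk [/e_inj /(congr1 (@projT1 _ _)) /= jE|].
  by rewrite jE ltnn in jk.
by apply: missH; apply: ltnW.
Qed.

Lemma adjoin_notin k (H : set L) (t : tuples X k) (z : X k) :
  misses_copies e k.+1 H -> ~ adjoin e H t (e (existT X k z)).
Proof.
move=> missH /adjoin_sub[|[s sk /e_inj sE]]; first exact: missH.
by move: sk; rewrite sE /= ltnn.
Qed.

Lemma card_adjoin k m (H : set L) (t : tuples X k) :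
  misses_copies e k H -> H #= `I_m -> adjoin e H t #= `I_(k + m).
Proof.
elim: k m H t => [|k IH] m H //= t missH cardH.
rewrite addSnnS; apply: IH; first exact: misses_copiesU1.
by apply: card_eq_setU1 => //; apply: missH.
Qed.

(** The set [H] has to be general for the induction, and [W] is avoided only
    outside [H]; for empty [H] the constructed set is disjoint from [W]. *)
Lemma inevitable_colour (C : Type) (n : nat) (sigma : subsets_of_card L n -> C) :
  (forall k, ~ injects (X k) (tuples X k * nat)) ->
  (forall F : subsets_of_card L n.-1,
    finite_set (sigma @` [set G : subsets_of_card L n |
      exists2 gamma : L, (~` val F) gamma & val G = val F `|` [set gamma]])) ->
  forall k m (H : set L), k + m = n -> misses_copies e k H -> H #= `I_m ->
  exists c, forall W, finite_set W ->
    exists (t : tuples X k) (G : subsets_of_card L n),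
      [/\ val G = adjoin e H t, sigma G = c & val G `&` W `<=` H].
Proof.
move=> X_big fin_ext; elim=> [|k IH] m H kmn missH cardH.
  have cardHn : subsets_of_card L n H by rewrite -kmn.
  exists (sigma (exist _ H (mem_set cardHn))) => W _.
  by exists tt, (exist _ H (mem_set cardHn)); split=> //= x [].
pose Hz z := e (existT X k z) |` H.
have /choice[c cP] z : exists c, forall W, finite_set W ->
    exists (t : tuples X k) (G : subsets_of_card L n),
      [/\ val G = adjoin e (Hz z) t, sigma G = c & val G `&` W `<=` Hz z].
  apply: (IH m.+1); first by rewrite -kmn addSnnS.
    exact: misses_copiesU1.
  by apply: card_eq_setU1 => //; exact: missH.
have /choice[t tP] z : exists t : tuples X k, exists2 G : subsets_of_card L n,
    val G = adjoin e (Hz z) t & sigma G = c z.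
  by have [t [G [GE sG _]]] := cP z set0 (finite_set0 _); exists t, G.
(* Over [t0] all the colours [c z] come from one set with [n - 1] points. *)
have [t0 inf_t0] := infinite_fibre _ _ t (X_big k).
have cardF : subsets_of_card L n.-1 (adjoin e H t0).
  rewrite -kmn /=; apply: card_adjoin => // j x jk.
  by apply: missH; apply: ltnW.
have fin_c : finite_set (c @` (t @^-1` [set t0])).
  have := fin_ext (exist _ (adjoin e H t0) (mem_set cardF)).
  apply: sub_finite_set => _ [z tz <-].
  have [G GE sG] := tP z; exists G => //=; exists (e (existT X k z)).
    exact: adjoin_notin.
  by rewrite GE tz adjoinU1 setUC.
have [c0 inf_c0] := infinite_pigeonhole _ _ _ _ inf_t0 fin_c.
exists c0 => W finW.
have [z [[_ cz] nWz]] : exists z, (t @^-1` [set t0] `&` c @^-1` [set c0]) z /\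
    ~ W (e (existT X k z)).
  have finW' : finite_set ((fun z => e (existT X k z)) @^-1` W).
    apply: finite_preimage finW => x y _ _ /e_inj.
    exact: eq_from_Tagged.
  by have [z [Az nWz]] := infinite_setN0 (infinite_setD inf_c0 finW'); exists z.
have [t1 [G [GE sG GW]]] := cP z W finW.
exists (t1, z), G; split=> //; first by rewrite sG cz.
by move=> x /[dup] -[_ Wx] /GW[xz|//]; case: nWz; rewrite -xz.
Qed.

End Adjoin.

(** Greedy choice: each set avoids the finite union [used] of its
    predecessors. *)
Lemma disjoint_sequence (L : Type) (n : nat) (P : set (subsets_of_card L n)) :
  (forall W, finite_set W -> exists2 G, P G & val G `&` W = set0) ->
  exists F : nat -> subsets_of_card L n,
    trivIset [set: nat] (fun j => val (F j)) /\ (forall j, P (F j)).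
Proof.
move=> avoid.
have /choice[g gP] W : exists G, finite_set W -> P G /\ val G `&` W = set0.
  have [finW|infW] := pselect (finite_set W).
    by have [G PG GW] := avoid W finW; exists G.
  by have [G PG _] := avoid set0 (finite_set0 _); exists G.
have finG (G : subsets_of_card L n) : finite_set (val G).
  by exists n; exact: set_mem (valP G).
pose used := fix used j := if j is i.+1 then used i `|` val (g (used i)) else set0.
have fin_used j : finite_set (used j).
  by elim: j => [|j IH] /=; [exact: finite_set0|rewrite finite_setU; split; last exact: finG].
have used_lt i j : i < j -> val (g (used i)) `<=` used j.
  elim: j => // j IH; rewrite ltnS leq_eqVlt => /predU1P[->|/IH sub].
    by move=> x; right.
  by move=> x /sub; left.
exists (fun j => g (used j)); split; last by move=> j; have [] := gP _ (fin_used j).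
apply: ltn_trivIset => j i ij; apply/seteqP; split=> // x [gi gj].
have [_ <-] := gP _ (fin_used j).
by split=> //; exact: used_lt ij _ gi.
Qed.

Theorem theoremB (L C : Type) (n : nat)
    (hL : [set: beth_omega] #<= [set: L]) (hn : (1 <= n)%N)
    (sigma : subsets_of_card L n -> C) :
  (exists F : nat -> subsets_of_card L n,
      trivIset [set: nat] (fun j => val (F j)) /\
      (forall i j : nat, sigma (F i) = sigma (F j)))
  \/
  (exists F : subsets_of_card L n.-1,
      infinite_set (sigma @` [set G : subsets_of_card L n |
        exists2 gamma : L, (~` val F) gamma & val G = val F `|` [set gamma]])).
Proof.
have [|/forallNP fin_ext] := pselect (exists F : subsets_of_card L n.-1,
  infinite_set (sigma @` [set G : subsets_of_card L n |
    exists2 gamma : L, (~` val F) gamma & val G = val F `|` [set gamma]])).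
  by right.
left; have [f f_inj] := (card_le_injects _ _).1 hL.
(* Distinct levels of [beth_omega] are disjoint, and each [X k] is one of its
   levels, so [e] places disjoint copies in [L]. *)
pose X k := beth (5 * k + 3).
pose e (s : {k & X k}) : L := f (existT beth (5 * projT1 s + 3) (projT2 s)).
have e_inj : injective e.
  move=> [i x] [j y] /f_inj /[dup] /(congr1 (@projT1 _ _)) /= ij.
  have {}ij : i = j by lia.
  by case: j / ij y => y /(@eq_from_Tagged nat beth) ->.
have card0 : (set0 : set L) #= `I_0 by rewrite II0 card_eq00.
have [c cP] := inevitable_colour e e_inj _ _ sigma beth_not_injects_tuples
  (fun F => contrapT (fin_ext F)) n 0 set0 (addn0 n) (fun _ _ _ => id) card0.
have [W finW|F [triF colF]] := disjoint_sequence _ _ [set G | sigma G = c].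
  have [t [G [_ sG GW]]] := cP W finW.
  by exists G => //; apply/seteqP; split.
by exists F; split=> // i j; rewrite !colF.
Qed.
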